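(* Let $\phi$ be a cyclic formula modalised in the variable $p$ and let $\psi$ be a cyclic formula with $\psi\simeq\phi[p:\psi]$. Then $\psi\simeq\digamma p.\phi$.
   Context: Labels: $\bot,\top$ and propositional variables (arity 0), $\neg,\Box$ (arity 1), $\wedge,\vee,\to$ (arity 2). A graph is $\langle V,r,S,\lambda\rangle$ with $V$ finite, root $r$, labelling $\lambda$, and $S:V\to V^{*}$ giving ordered successors (length = arity of the label), $S_i(a)$ the $i$-th; every vertex is reachable from $r$. A cycle is a set of pairwise distinct vertices $a_0,\dots,a_{k-1}$ with $a_{j+1}$ a successor of $a_j$ and $a_0$ a successor of $a_{k-1}$. A (cyclic) formula is a graph in which every cycle contains a $\Box$-labelled vertex. A bisimulation is a relation $R$ with $aRa'$ implying equal labels and $S_i(a)RS'_i(a')$ for all $i$; $\phi\simeq\psi$ iff some bisimulation relates the roots. $\phi[p:\psi]$: disjoint union of $\phi$ and $\psi$, identifying each $p$-labelled vertex of $\phi$ with the root of $\psi$ (keeping the label of $\psi$'s root). $\phi$ is modalised in $p$ if every path from the root to a $p$-labelled vertex contains a $\Box$-labelled vertex; then $\digamma p.\phi$ is obtained by identifying the root with all $p$-labelled vertices, keeping the root's label. *)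

(* Defs.v *)
From mathcomp Require Import all_boot.

Set Implicit Arguments.
Unset Strict Implicit.
Unset Printing Implicit Defensive.

Inductive label (Var : Type) : Type :=
  LBot | LTop | LVar of Var | LNeg | LBox | LAnd | LOr | LImp.

Arguments LBot {Var}.
Arguments LTop {Var}.
Arguments LNeg {Var}.
Arguments LBox {Var}.
Arguments LAnd {Var}.
Arguments LOr {Var}.
Arguments LImp {Var}.

Definition arity (Var : Type) (l : label Var) : nat :=
  match l with
  | LBot | LTop | LVar _ => 0
  | LNeg | LBox => 1
  | LAnd | LOr | LImp => 2
  end.

Definition is_box (Var : Type) (l : label Var) : bool :=
  if l is LBox then true else false.

Definition is_var (Var : eqType) (p : Var) (l : label Var) : bool :=
  if l is LVar q then q == p else false.

(* A graph in which vertices unreachable from the root are still allowed. *)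
Record pregraph (Var : Type) := Pregraph {
  vert :> finType;
  rt : vert;
  lab : vert -> label Var;
  succ : vert -> seq vert;
  size_succ : forall a, size (succ a) = arity (lab a) }.

Arguments rt {Var}.

Definition edge (Var : Type) (G : pregraph Var) : rel G :=
  fun a b => b \in succ a.

Arguments edge {Var}.

Record graph (Var : Type) := Graph {
  pregraph_of :> pregraph Var;
  reachable : forall a : pregraph_of,
    connect (edge pregraph_of) (rt pregraph_of) a }.

Definition guarded (Var : Type) (G : pregraph Var) : Prop :=
  forall c : seq G, c != [::] -> uniq c -> cycle (edge G) c ->
    has (fun a => is_box (lab a)) c.

Record formula (Var : Type) := Formula {
  graph_of :> graph Var;
  formula_guarded : guarded graph_of }.

(* Since the labels agree, related vertices have equally many successors and
   the default value of [nth] is never used. *)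
Definition bisimulation (Var : Type) (G H : pregraph Var)
    (R : G -> H -> Prop) : Prop :=
  forall (a : G) (b : H), R a b ->
    lab a = lab b /\
    (forall i, i < arity (lab a) -> R (nth a (succ a) i) (nth b (succ b) i)).

Definition bisimilar (Var : Type) (phi psi : formula Var) : Prop :=
  exists R : phi -> psi -> Prop, bisimulation R /\ R (rt phi) (rt psi).

(* The empty path is included, so the root of a formula that is modalised in p
   does not carry the label p. *)
Definition modalised (Var : eqType) (p : Var) (phi : formula Var) : Prop :=
  forall s : seq phi, path (edge phi) (rt phi) s ->
    is_var p (lab (last (rt phi) s)) ->
    has (fun a => is_box (lab a)) (rt phi :: s).

Section Generated.
Variables (Var : Type) (G : pregraph Var).

Definition gen_vert : finType := {a : G | connect (edge G) (rt G) a}.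

Definition gen_rt : gen_vert := exist _ (rt G) (connect0 (edge G) (rt G)).
Definition gen_lab (a : gen_vert) : label Var := lab (val a).
Definition gen_succ (a : gen_vert) : seq gen_vert := pmap insub (succ (val a)).

Lemma gen_size_succ (a : gen_vert) : size (gen_succ a) = arity (gen_lab a).
Proof.
rewrite size_pmap_sub -size_succ; apply/eqP; rewrite -all_count.
apply/allP => b ab; apply: connect_trans (valP a) _; exact: connect1.
Qed.

Definition gen_pre : pregraph Var :=
  @Pregraph Var gen_vert gen_rt gen_lab gen_succ gen_size_succ.

Lemma gen_edge (a b : gen_pre) : edge gen_pre a b = edge G (val a) (val b).
Proof. by rewrite /edge /= /gen_succ mem_pmap_sub. Qed.

Lemma gen_reachable (a : gen_pre) : connect (edge gen_pre) (rt gen_pre) a.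
Proof.
have lift s : forall u : gen_pre, path (edge G) (val u) s ->
    last (val u) s = val a -> connect (edge gen_pre) u a.
  elim: s => [|y s IHs] u /=; first by move=> _ /val_inj ->; apply: connect0.
  case/andP=> uy ys las.
  have ry : connect (edge G) (rt G) y.
    by apply: connect_trans (valP u) _; exact: connect1.
  apply: (@connect_trans _ _ (exist _ y ry : gen_pre)); last exact: IHs.
  by apply: connect1; rewrite gen_edge.
by case/connectP: (valP a) => s ps las; apply: (lift s (rt gen_pre)).
Qed.

Definition generated : graph Var := Graph gen_reachable.

Lemma generated_guarded : guarded G -> guarded generated.
Proof.
move=> gG c c0 uc cc.
have: has (fun a : G => is_box (lab a)) (map val c).
  apply: gG; first by case: c c0 {uc cc}.
    by rewrite map_inj_uniq //; apply: val_inj.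
  case: c cc {c0 uc} => //= x c; rewrite -map_rcons path_map.
  by apply: sub_path => a b; move: (gen_edge a b) => /= ->.
by rewrite has_map.
Qed.

End Generated.

Section Substitution.
Variables (Var : eqType) (phi : formula Var) (p : Var) (psi : formula Var).

(* The quotient of the disjoint union of phi and psi that identifies the
   p-labelled vertices of phi with the root of psi is represented by the other
   vertices of phi together with all vertices of psi; [subst_in] is the
   quotient map on phi. *)
Definition subst_vert : finType :=
  ({a : phi | ~~ is_var p (lab a)} + psi)%type.

Definition subst_in (a : phi) : subst_vert :=
  if insub a is Some u then inl u else inr (rt psi).

Definition subst_lab (x : subst_vert) : label Var :=
  match x with inl u => lab (val u) | inr b => lab b end.

Definition subst_succ (x : subst_vert) : seq subst_vert :=
  match x with
  | inl u => map subst_in (succ (val u))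
  | inr b => map inr (succ b)
  end.

Lemma subst_size_succ x : size (subst_succ x) = arity (subst_lab x).
Proof. by case: x => u /=; rewrite size_map size_succ. Qed.

Definition subst_pre : pregraph Var :=
  @Pregraph Var subst_vert (subst_in (rt phi)) subst_lab subst_succ
    subst_size_succ.

Lemma subst_guarded : guarded subst_pre.
Proof.
have inr_path s : forall b : psi, path (edge subst_pre) (inr b) s ->
    exists2 t : seq psi, s = map inr t & path (edge psi) b t.
  elim: s => [|y s IHs] b /=; first by exists [::].
  case/andP=> /mapP[b' bb' ->] /IHs[t -> pt].
  by exists (b' :: t) => //=; apply/andP.
move=> c c0 uc cc.
have [b bc|noinr] := pickP (fun b : psi => (inr b : subst_pre) \in c).
  case/rot_to: bc => i s rs; rewrite -(has_rot i) rs.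
  move: uc cc; rewrite -(rot_uniq i) -(rot_cycle i) rs => us /=.
  case/inr_path=> t; case/lastP: t => [|t b']; first by case: (s).
  rewrite map_rcons => /rcons_inj[st [<-]] pt.
  move: us; rewrite st -(map_cons (inr : psi -> subst_pre)) has_map => us.
  apply: (@formula_guarded _ psi (b :: t) isT _ pt).
  by move: us; rewrite map_inj_uniq // => ? ? [].
have inl_c (d : seq subst_pre) : {subset d <= c} -> exists t, d = map inl t.
  elim: d => [|x d IHd] sd; first by exists [::].
  have [|t ->] := IHd; first by move=> y yd; rewrite sd // inE yd orbT.
  case: x sd => [u|b] sd; first by exists (u :: t).
  by have := noinr b; rewrite sd // mem_head.
have [//|t ct] := inl_c c.
have gt: has (fun a : phi => is_box (lab a)) (map val t).
  apply: formula_guarded; first by move: c0; rewrite ct; case: (t).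
    rewrite map_inj_uniq; last exact: val_inj.
    by move: uc; rewrite ct map_inj_uniq // => ? ? [].
  move: cc; rewrite ct; case: t {ct} => //= u t.
  rewrite -!map_rcons !path_map; apply: sub_path => v w /= /mapP[b vb].
  rewrite /subst_in; case: insubP => // w' _ w'b [->].
  by rewrite w'b.
by move: gt; rewrite ct !has_map.
Qed.

(* If p does not occur in phi, the copy of psi is not reachable and has to be
   discarded. *)
Definition subst : formula Var :=
  Formula (generated_guarded subst_guarded).

End Substitution.

Section FixedPoint.
Variables (Var : eqType) (p : Var) (phi : formula Var).
Hypothesis phi_mod : modalised p phi.

Lemma rt_not_var : ~~ is_var p (lab (rt phi)).
Proof.
apply/negP => prt; have := phi_mod (s := [::]) isT prt.
by move: prt => /=; case: (lab _).
Qed.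

(* The quotient of phi that identifies the p-labelled vertices with the root is
   represented by the vertices not labelled p; the quotient map is
   [insubd fix_rt]. *)
Definition fix_vert : finType := {a : phi | ~~ is_var p (lab a)}.

Definition fix_rt : fix_vert := exist _ (rt phi) rt_not_var.
Definition fix_lab (u : fix_vert) : label Var := lab (val u).
Definition fix_succ (u : fix_vert) : seq fix_vert :=
  map (insubd fix_rt) (succ (val u)).

Lemma fix_size_succ u : size (fix_succ u) = arity (fix_lab u).
Proof. by rewrite size_map size_succ. Qed.

Definition fix_pre : pregraph Var :=
  @Pregraph Var fix_vert fix_rt fix_lab fix_succ fix_size_succ.

Lemma fix_reachable (a : fix_pre) : connect (edge fix_pre) (rt fix_pre) a.
Proof.
have lift s : forall u : fix_pre, path (edge phi) (val u) s ->
    last (val u) s = val a -> connect (edge fix_pre) u a.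
  elim: s => [|y s IHs] u /=; first by move=> _ /val_inj ->; apply: connect0.
  case/andP=> uy ys las.
  have [py|npy] := boolP (is_var p (lab y)).
    have sy : succ y = [::].
      by apply: size0nil; rewrite size_succ; move: py; case: (lab y).
    case: s ys las {IHs} => [_ ya|z s] /=; last by rewrite /edge sy.
    by move: py; rewrite [y]ya (negbTE (valP a)).
  apply: (@connect_trans _ _ (exist _ y npy : fix_pre)); last exact: IHs.
  apply/connect1/mapP; exists y => //.
  by apply: val_inj; rewrite val_insubd npy.
by case/connectP: (reachable (val a)) => s ps las; apply: (lift s (rt fix_pre)).
Qed.

Definition fix_graph : graph Var := Graph fix_reachable.

Lemma fix_guarded : guarded fix_graph.
Proof.
have lift s : forall u : fix_pre, path (edge fix_pre) u s ->
    rt fix_pre \notin s -> path (edge phi) (val u) (map val s).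
  elim: s => //= v s IHs u /andP[/mapP[b ub vb] ps].
  rewrite inE negb_or => /andP[rv rs]; rewrite IHs // andbT.
  move: rv; rewrite vb /insubd; case: insubP => [w _ -> //|_].
  by rewrite /= eqxx.
move=> c c0 uc cc.
suff: has (fun a : phi => is_box (lab a)) (map val c) by rewrite has_map.
have uval (d : seq fix_pre) : uniq d -> uniq (map val d).
  by rewrite map_inj_uniq //; apply: val_inj.
have [rc|rc] := boolP (rt fix_pre \in c); last first.
  apply: formula_guarded; [by case: (c) c0 | exact: uval |].
  case: c {c0 uc} cc rc => //= u c cc rc.
  by rewrite -map_rcons lift // mem_rcons.
case/rot_to: rc => i s rs.
rewrite -(has_rot i) -map_rot rs.
move: uc cc; rewrite -(rot_uniq i) -(rot_cycle i) rs => us.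
have rs' : rt fix_pre \notin s by case/andP: us.
rewrite /= rcons_path => /andP[/lift/(_ rs') ps /mapP[b lb rb]].
have pb : path (edge phi) (rt phi) (rcons (map val s) b).
  by rewrite rcons_path ps -[rt phi]/(val (rt fix_pre)) last_map.
have [vb|nvb] := boolP (is_var p (lab b)).
  have := phi_mod pb; rewrite last_rcons => /(_ vb).
  rewrite /= has_rcons (_ : is_box (lab b) = false) //.
  by move: vb; case: (lab b).
apply: (@formula_guarded _ phi (rt phi :: map val s)) => //.
  exact: (uval _ us).
have br : b = rt phi by have /(congr1 val) := rb; rewrite val_insubd nvb.
by rewrite br in pb.
Qed.

Definition fixp : formula Var := @Formula Var fix_graph fix_guarded.

End FixedPoint.

(* Main.v *)
(** Relate a vertex y of psi to a vertex u of the fixed point when y is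
    bisimilar to the copy of u in phi[p:psi]. The only successors whose meaning
    differs in the two graphs are the p-labelled vertices of phi: they lead to
    the root of psi in phi[p:psi] and to the root of phi in the fixed point.
    The hypothesis says exactly that those two roots are bisimilar, so the
    relation is a bisimulation. *)
Require Import Defs.
From mathcomp Require Import all_boot.

Set Implicit Arguments.
Unset Strict Implicit.
Unset Printing Implicit Defensive.

(** Stated on pregraphs and at any vertex, so that it applies to [subst_pre] before unreachable
    vertices are discarded. *)
Definition vertex_bisimilar (Var : Type) (G H : pregraph Var) (a : G) (b : H) :=
  exists R : G -> H -> Prop, bisimulation R /\ R a b.

Section VertexBisimilarity.
Variable Var : Type.
Implicit Types G H K : pregraph Var.

(** A bisimulation witnessing a pair also witnesses its successors. *)
Lemma vertex_bisimilarP G H :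
  bisimulation (@vertex_bisimilar Var G H).
Proof.
move=> a b [R [bR Rab]]; have [lab_ab Rsucc] := bR _ _ Rab.
by split=> // i lt_i; exists R; split=> //; apply: Rsucc.
Qed.

Lemma vertex_bisimilar_sym G H (a : G) (b : H) :
  vertex_bisimilar a b -> vertex_bisimilar b a.
Proof.
case=> R [bR Rab]; exists (fun y x => R x y); split=> // y x Rxy.
by have [lab_xy Rsucc] := bR _ _ Rxy; rewrite -lab_xy.
Qed.

Lemma vertex_bisimilar_trans G H K (a : G) (b : H) (c : K) :
  vertex_bisimilar a b -> vertex_bisimilar b c -> vertex_bisimilar a c.
Proof.
case=> R [bR Rab] [S [bS Sbc]].
exists (fun x z => exists2 y, R x y & S y z); split; last by exists b.
move=> x z [y Rxy Syz].
have [lab_xy Rsucc] := bR _ _ Rxy; have [lab_yz Ssucc] := bS _ _ Syz.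
split=> [|i lt_i]; first by rewrite lab_xy.
by exists (nth y (succ y) i); [apply: Rsucc | apply: Ssucc; rewrite -lab_xy].
Qed.

Lemma vertex_bisimilar_morphism G H (f : G -> H) :
    (forall a, lab (f a) = lab a) ->
    (forall a, succ (f a) = map f (succ a)) ->
  forall a, vertex_bisimilar a (f a).
Proof.
move=> lab_f succ_f a; exists (fun x y => y = f x); split=> // x _ ->.
by split=> // i lt_i; rewrite succ_f (nth_map x) // size_succ.
Qed.

(** Successors of reachable vertices are reachable, so [pmap insub] drops nothing and [val] is a
    morphism. *)
Lemma vertex_bisimilar_generated G (a : generated G) :
  vertex_bisimilar a (val a : G).
Proof.
apply: (vertex_bisimilar_morphism (G := generated G)) => // {}a.
rewrite /= /gen_succ (pmap_filter (insubK _)); apply/esym/all_filterP.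
apply/allP=> b ab; rewrite isSome_insub.
by apply: connect_trans (valP a) _; apply: connect1.
Qed.

End VertexBisimilarity.

Theorem theorem2p14 (Var : eqType) (p : Var) (phi psi : formula Var)
    (phi_mod : modalised p phi) :
  bisimilar psi (subst phi p psi) -> bisimilar psi (fixp phi_mod).
Proof.
move=> psi_subst; pose S := subst_pre phi p psi.
(* Modalisation keeps the root of [phi] from being labelled [p]. *)
have rt_inl : subst_in p psi (rt phi) = inl (fix_rt phi_mod).
  by rewrite /subst_in -[rt phi]/(val (fix_rt phi_mod)) valK.
have bis_rt : vertex_bisimilar (rt psi) (inl (fix_rt phi_mod) : S).
  rewrite -rt_inl; apply: vertex_bisimilar_trans psi_subst _.
  exact: (vertex_bisimilar_generated (rt (generated S))).
have bis_inr (b : psi) : vertex_bisimilar (inr b : S) b.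
  apply: vertex_bisimilar_sym.
  exact: (vertex_bisimilar_morphism (H := S) (f := inr)).
exists (fun y u => vertex_bisimilar y (inl u : S)); split=> // y u bis_yu.
have [lab_yu bis_succ] := vertex_bisimilarP bis_yu.
split=> // i lt_i; have := bis_succ i lt_i.
have lt_iu : i < size (succ (val u)) by rewrite size_succ -[lab _]lab_yu.
rewrite /= /fix_succ !(nth_map (val u)) // /subst_in /insubd.
(* A successor not labelled [p] is kept by both quotients; one labelled [p] becomes [inr (rt psi)]
   in one and [fix_rt] in the other. *)
case: insubP => //= _ bis_y.
exact: vertex_bisimilar_trans (vertex_bisimilar_trans bis_y (bis_inr _)) bis_rt.
Qed.
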